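(* Let $p\in(0,1)$ and $\beta=p/(1-p)$, let $\Xi_n$ be the position at time $n$ of the laziest elephant random walk with power law memory with parameters $(p,\beta)$, and let $\Xi_\infty=\lim_{n\to\infty}\Xi_n\in\mathbb{N}\cup\{+\infty\}$. Then $P(\Xi_\infty<+\infty)=1$.
   Context: For $n\in\mathbb{N}=\{1,2,\dots\}$ put $\mu_n:=\dfrac{\Gamma(n+\beta)}{\Gamma(n)\Gamma(\beta+1)}$. Laziest elephant random walk with power law memory, with parameters $p\in(0,1)$, $\beta>-1$: let $\{\beta_{n+1}:n\in\mathbb{N}\}$ be independent random variables with $$P(\beta_{n+1}=k)=\frac{\beta+1}{n}\cdot\frac{\mu_k}{\mu_{n+1}}\quad (1\le k\le n),$$ and $P(\beta_{n+1}=k)=0$ otherwise (this is a probability mass function). Set $X_1\equiv 1$ and, for $n\ge 1$, $X_{n+1}=X_{\beta_{n+1}}$ with probability $p$ and $X_{n+1}=0$ with probability $1-p$; that is, $X_{n+1}=\alpha_{n+1}X_{\beta_{n+1}}$, where the $\alpha_{n+1}$ are i.i.d. Bernoulli($p$) random variables independent of $\{\beta_{n+1}\}$. The walk is $\Xi_0=0$, $\Xi_n=\sum_{k=1}^n X_k$. *)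

(* Defs.v *)
From HB Require Import structures.
From mathcomp Require Import all_boot all_order all_algebra finmap.
From mathcomp Require Import all_classical all_reals all_analysis.

Set Implicit Arguments.
Unset Strict Implicit.
Unset Printing Implicit Defensive.

Import Order.TTheory GRing.Theory Num.Theory.
Import numFieldNormedType.Exports.

Local Open Scope classical_set_scope.
Local Open Scope ring_scope.

(* Meaningful for 0 < x only: otherwise the integral diverges and Rintegral
   returns the junk value 0. *)
Definition Gamma (R : realType) (x : R) : R :=
  \int[lebesgue_measure]_(t in `]0, +oo[) (t `^ (x - 1) * expR (- t)).

Definition mu (R : realType) (beta : R) (n : nat) : R :=
  Gamma (n%:R + beta) / (Gamma n%:R * Gamma (beta + 1)).

Section independence.
Context (d : measure_display) (T : measurableType d) (R : realType).
Variable P : probability T R.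

Definition sigma_RV (d' : measure_display) (T' : measurableType d')
    (X : T -> T') : set (set T) :=
  preimage_set_system setT X measurable.

Definition sigma_RVs (d' : measure_display) (T' : measurableType d')
    (D : set nat) (X : nat -> T -> T') : set (set T) :=
  <<s \bigcup_(n in D) sigma_RV (X n) >>.

Definition independent_RVs (d' : measure_display) (T' : measurableType d')
    (D : set nat) (X : nat -> T -> T') : Prop :=
  forall (J : {fset nat}) (E : nat -> set T),
    [set` J] `<=` D ->
    (forall j, j \in J -> sigma_RV (X j) (E j)) ->
    P (\bigcap_(j in [set` J]) E j) = (\prod_(j <- J) P (E j))%E.

Definition independent_classes (F G : set (set T)) : Prop :=
  forall A B, F A -> G B -> P (A `&` B) = (P A * P B)%E.

End independence.

(* Indices are the mathematical ones: only [X n] for n >= 1 and [alpha n],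
   [b n] (usually written beta_n) for n >= 2 matter; the other terms are
   unconstrained and unused.  Bernoulli variables are boolean, and [alpha n]
   is coerced to 0 or 1 in [lerw_step].  The classes in [lerw_alpha_b_indep]
   are the sigma-algebras generated by the two whole families. *)
Record laziest_erw (d : measure_display) (T : measurableType d) (R : realType)
    (P : probability T R) (p beta : R)
    (alpha : nat -> {RV P >-> bool}) (b : nat -> {RV P >-> nat})
    (X : nat -> {RV P >-> nat}) : Prop := LaziestERW {
  lerw_p : 0 < p < 1;
  lerw_beta : -1 < beta;
  lerw_b_pmf : forall n k : nat, (1 <= n)%N ->
    P [set w | b n.+1 w = k] =
      (if (1 <= k <= n)%N
       then (beta + 1) / n%:R * (mu beta k / mu beta n.+1) else 0)%:E;
  lerw_b_indep :
    independent_RVs P [set n | (2 <= n)%N] (fun n => b n : T -> nat);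
  lerw_alpha_bernoulli : forall n : nat, (1 <= n)%N ->
    distribution P (alpha n.+1) =1 bernoulli_prob p;
  lerw_alpha_indep :
    independent_RVs P [set n | (2 <= n)%N] (fun n => alpha n : T -> bool);
  lerw_alpha_b_indep :
    independent_classes P
      (sigma_RVs [set n | (2 <= n)%N] (fun n => alpha n : T -> bool))
      (sigma_RVs [set n | (2 <= n)%N] (fun n => b n : T -> nat));
  lerw_init : forall w, X 1%N w = 1%N;
  lerw_step : forall (n : nat) w, (1 <= n)%N ->
    X n.+1 w = (alpha n.+1 w * X (b n.+1 w) w)%N
}.

Section walk.
Context (T : Type) (R : realType).
Variable X : nat -> T -> nat.

Definition walk (n : nat) (w : T) : nat := (\sum_(1 <= k < n.+1) X k w)%N.

Definition walk_infty (w : T) : \bar R :=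
  limn (fun n => ((walk n w)%:R%:E : \bar R)).

Lemma walk_nondecreasing w : {homo walk^~ w : m n / (m <= n)%N}.
Proof.
move=> m n mn; rewrite /walk [leqRHS](big_cat_nat (n := m.+1)) //=.
exact: leq_addr.
Qed.

Lemma is_cvg_walk w : cvgn (fun n => ((walk n w)%:R%:E : \bar R)).
Proof.
apply: ereal_nondecreasing_is_cvgn => m n mn.
by rewrite lee_fin ler_nat walk_nondecreasing.
Qed.

Lemma walk_infty_nat w :
  (exists n : nat, walk_infty w = n%:R%:E) \/ walk_infty w = +oo%E.
Proof.
have [[N hN]|unb] := pselect (exists N, forall n, (walk n w <= N)%N).
- left.
  have exw : exists k, `[< exists n, walk n w = k >].
    by exists (walk 0 w); apply/asboolP; exists 0%N.
  have bw k : `[< exists n, walk n w = k >] -> (k <= N)%N.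
    by move=> /asboolP[n <-].
  case: (ex_maxnP exw bw) => k /asboolP[n0 n0k] maxk; exists k.
  apply/cvg_lim => //; apply: cvg_near_cst.
  exists n0 => // n /= n0n; congr (_%:R%:E).
  apply/eqP; rewrite eqn_leq; apply/andP; split.
    by apply: maxk; apply/asboolP; exists n.
  by rewrite -n0k walk_nondecreasing.
- right; apply/cvg_lim => //; apply/cvgeryP/cvgryPge => A.
  have [n0 hn0] : exists n0, (Num.bound `|A| <= walk n0 w)%N.
    apply: contrapT => h; apply: unb; exists (Num.bound `|A|) => n.
    by rewrite leqNgt; apply/negP => hn; apply: h; exists n; exact: ltnW.
  exists n0 => // n /= n0n.
  apply: (le_trans (ler_norm A)).
  apply: (le_trans (ltW (archi_boundP (normr_ge0 A)))).
  by rewrite ler_nat (leq_trans hn0)// walk_nondecreasing.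
Qed.

End walk.

(* Main.v *)
Require Import Defs.
From HB Require Import structures.
From mathcomp Require Import all_boot all_order all_algebra finmap.
From mathcomp Require Import all_classical all_reals all_analysis.
From mathcomp Require Import ring lra.

Set Implicit Arguments.
Unset Strict Implicit.
Unset Printing Implicit Defensive.

Import Order.TTheory GRing.Theory Num.Theory.
Import numFieldNormedType.Exports.

Local Open Scope classical_set_scope.
Local Open Scope ring_scope.

(** Let [M_n = \sum_(1 <= k <= n) mu_k X_k / mu_n]. Given the first [n] steps,
    the next one is [1] with probability [q_n = e_n M_n], where
    [e_n = beta / (n + beta)], and is [0] otherwise; then
    [M_(n+1) = (1 - e_n) M_n + X_(n+1)]. The relation [beta = p / (1 - p)]
    makes [M] a martingale of mean [1] (expect_mass). Its fluctuations
    nevertheless drive [M_n] to [0] in probability, as for a critical branching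
    process, while every nonzero step puts [M] back to at least [1]; so the
    nonzero steps must come to an end.

    The proof measures [M_n] by the bounded concave function
    [f t = t / (1 + t)]. One step lowers the expectation of [f M_n] by at least
    [e_n (1 - p)] times the expectation of [g M_n], with
    [g t = t / ((1 + t)^2 (2 + t))] (damp_drift); here [q_n <= p] is used, which
    says that a step survives only if it is remembered and kept. As
    [\sum_n e_n] diverges and [f >= 0], the expectation of [g M_n] comes
    arbitrarily close to [0]. Since [g] vanishes only at [0] and at infinity,
    and the mean of [M_n] is [1], so does the expectation of [f M_n]
    (expect_damp_small). Finally [f M_n] is a nonnegative supermartingale that is
    at least [1/2] after a nonzero step, so the maximal inequality bounds the
    probability of a nonzero step after time [n] by twice the expectation of
    [f M_n] (expect_new_hit_le).

    All this needs only finitely many steps at a time, so expectations are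
    written as the iterated transition operator [expect] of the chain of zero
    patterns of [X_1, ..., X_n]; pattern_law derives this chain from the
    independence of the [alpha]s and [b]s. The Gamma function enters only through
    the ratios [mu_n / mu_(n+1) = n / (n + beta)], and these follow from the fact
    that the law of [b] has total mass [1] (weight_rec). *)

(** * The chain of zero patterns at criticality *)

Section zero_pattern_chain.
Context {R : realType}.
Implicit Types (p beta t : R) (x : seq bool) (n : nat).

Definition forget beta n : R := beta / (n%:R + beta).

(** The patterns are stored latest step first, so [x] of size [n] records
    whether [X_n, ..., X_1] are nonzero, and [mass beta x] is the martingale
    [\sum_(1 <= k <= n) mu_k X_k / mu_n], written through its recursion because
    [mu_n / mu_(n.+1) = 1 - forget beta n]. *)
Fixpoint mass beta x : R :=
  if x is v :: y then (1 - forget beta (size y)) * mass beta y + v%:R else 0.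

Definition hit beta x : R := forget beta (size x) * mass beta x.

Definition step beta (F : seq bool -> R) x : R :=
  hit beta x * F (true :: x) + (1 - hit beta x) * F (false :: x).

(** The chain starts from the pattern of [X_1 = 1], hence the shift: the
    patterns met after [n] transitions have size [n.+1]. *)
Fixpoint expect beta n (F : seq bool -> R) : R :=
  if n is m.+1 then expect beta m (step beta F) else F [:: true].

Definition damp t : R := t / (1 + t).

Definition damp_loss t : R := t / ((1 + t) ^+ 2 * (2 + t)).

Section critical.
Context (p beta : R) (hp : 0 < p < 1) (hbeta : beta = p / (1 - p)).

Let p_gt0 : 0 < p. Proof. by case/andP: hp. Qed.
Let p_lt1 : p < 1. Proof. by case/andP: hp. Qed.

Lemma beta_gt0 : 0 < beta.
Proof. by rewrite hbeta divr_gt0// subr_gt0. Qed.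

Lemma beta_critical : beta * (1 - p) = p.
Proof. by rewrite hbeta divfK// subr_eq0 gt_eqF. Qed.

Lemma addn_beta_gt0 n : 0 < n%:R + beta.
Proof. by rewrite ltr_wpDl// beta_gt0. Qed.

Lemma forget_gt0 n : 0 < forget beta n.
Proof. by rewrite divr_gt0 ?beta_gt0 ?addn_beta_gt0. Qed.

Lemma forget_le1 n : forget beta n <= 1.
Proof. by rewrite ler_pdivrMr ?addn_beta_gt0// mul1r lerDr. Qed.

Lemma mass_ge0 x : 0 <= mass beta x.
Proof.
elim: x => [|v x ih] //=; rewrite addr_ge0// mulr_ge0//.
by rewrite subr_ge0 forget_le1.
Qed.

Lemma mass_le x : mass beta x <= (1 - p) * ((size x)%:R + beta).
Proof.
elim: x => [|v x ih] /=.
  by rewrite mulr_ge0 ?subr_ge0 ?(ltW p_lt1)// ltW// addn_beta_gt0.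
have hb := beta_critical; have h := addn_beta_gt0 (size x).
have hv : v%:R <= 1 :> R by case: v => //=.
have e1 : 1 - forget beta (size x) = (size x)%:R / ((size x)%:R + beta).
  by rewrite /forget; field; rewrite gt_eqF.
have : (1 - forget beta (size x)) * mass beta x <= (1 - p) * (size x)%:R.
  rewrite e1 mulrAC ler_pdivrMr// -mulrA mulrCA ler_wpM2l//.
rewrite -natr1; nra.
Qed.

Lemma hit_ge0 x : 0 <= hit beta x.
Proof. by rewrite mulr_ge0 ?mass_ge0// ltW// forget_gt0. Qed.

(** The next step repeats an earlier one with probability [p] only. *)
Lemma hit_le x : hit beta x <= p.
Proof.
rewrite /hit /forget mulrAC ler_pdivrMr ?addn_beta_gt0//.
rewrite -[in leRHS]beta_critical -mulrA ler_wpM2l ?(ltW beta_gt0)//.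
exact: mass_le.
Qed.

Lemma hit_le1 x : hit beta x <= 1.
Proof. exact: le_trans (hit_le x) (ltW p_lt1). Qed.

Lemma step_le F G x : (forall v, F (v :: x) <= G (v :: x)) ->
  step beta F x <= step beta G x.
Proof.
move=> FG; rewrite lerD// ler_wpM2l ?hit_ge0//.
by rewrite subr_ge0 hit_le1.
Qed.

Lemma expect_le n F G : (forall x, size x = n.+1 -> F x <= G x) ->
  expect beta n F <= expect beta n G.
Proof.
elim: n F G => [|n ih] F G FG /=; first exact: FG.
by apply: ih => x sx; apply: step_le => v; apply: FG; rewrite /= sx.
Qed.

Lemma eq_expect n F G : (forall x, size x = n.+1 -> F x = G x) ->
  expect beta n F = expect beta n G.
Proof.
elim: n F G => [|n ih] F G FG /=; first exact: FG.
by apply: ih => x sx; rewrite /step !FG //= sx.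
Qed.

Lemma expect_lincomb n a c F G :
  expect beta n (fun x => a * F x + c * G x) =
  a * expect beta n F + c * expect beta n G.
Proof.
elim: n F G => [//|n ih] F G /=; rewrite -ih.
by apply: eq_expect => x _; rewrite /step; ring.
Qed.

Lemma expect_cst n a : expect beta n (fun=> a) = a.
Proof.
elim: n => [//|n ih] /=; rewrite -[RHS]ih.
by apply: eq_expect => x _; rewrite /step; ring.
Qed.

(** This is where [beta = p / (1 - p)] enters: the mass lost to the change of
    normalization is exactly what the expected new step brings back. *)
Lemma expect_mass n : expect beta n (mass beta) = 1.
Proof.
elim: n => [|n ih] /=; first by rewrite mulr0 add0r.
by rewrite -[RHS]ih; apply: eq_expect => x _; rewrite /step /hit /=; ring.
Qed.

Lemma damp_loss_ge0 t : 0 <= t -> 0 <= damp_loss t.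
Proof. by move=> t0; rewrite divr_ge0// mulr_ge0 ?exprn_ge0 ?addr_ge0. Qed.

(** [damp] is strictly concave, so a martingale step strictly lowers its
    expectation; [damp_loss] bounds the loss below, relative to the size [e] of
    the step. *)
Lemma damp_drift e t : 0 <= e <= 1 -> 0 <= t -> e * t <= p ->
  e * t * damp ((1 - e) * t + 1) + (1 - e * t) * damp ((1 - e) * t) <=
  damp t - e * ((1 - p) * damp_loss t).
Proof.
move=> /andP[e0 e1] t0 etp.
set a := (1 - e) * t.
have a0 : 0 <= a by rewrite mulr_ge0// subr_ge0.
have at_ : a <= t by rewrite /a; nra.
have -> : e * t * damp (a + 1) + (1 - e * t) * damp a =
    damp t - e * ((1 - e * t) * (t / ((1 + t) * ((1 + a) * (2 + a))))).
  have -> : damp t - e * ((1 - e * t) * (t / ((1 + t) * ((1 + a) * (2 + a))))) =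
      damp t - e * t * (1 - e * t) / ((1 + t) * ((1 + a) * (2 + a))) by ring.
  have -> : e * t = t - a by rewrite /a; ring.
  by rewrite /damp; field; do ?[apply/andP; split]; rewrite ?gt_eqF//; lra.
rewrite lerB// ler_wpM2l// ler_pM//.
- by rewrite subr_ge0 ltW.
- exact: damp_loss_ge0.
- by rewrite lerB.
- have pos : 0 < (1 + a) * (2 + a) by rewrite mulr_gt0//; lra.
  rewrite /damp_loss ler_wpM2l// lef_pV2 ?posrE.
  + rewrite expr2 -mulrA ler_wpM2l; [lra|lra|].
    by apply: ler_pM; lra.
  + by rewrite mulr_gt0 ?exprn_gt0//; lra.
  + by rewrite mulr_gt0//; lra.
Qed.

Lemma step_damp x : step beta (damp \o mass beta) x <=
  damp (mass beta x) - forget beta (size x) * ((1 - p) * damp_loss (mass beta x)).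
Proof.
rewrite /step /= addr0; apply: damp_drift.
- by rewrite ltW ?forget_gt0//= forget_le1.
- exact: mass_ge0.
- exact: hit_le.
Qed.

Lemma expect_damp_le n : expect beta n (damp \o mass beta) <=
  damp 1 - (1 - p) *
    \sum_(i < n) forget beta i.+1 * expect beta i (damp_loss \o mass beta).
Proof.
elim: n => [|n ih]; first by rewrite big_ord0 mulr0 subr0 /= mulr0 add0r.
rewrite big_ord_recr /=.
set u := expect beta n (damp_loss \o _); set s := \sum_(_ < _) _.
apply: (@le_trans _ _ (1 * expect beta n (damp \o mass beta) +
    (- (forget beta n.+1 * (1 - p))) * u)); last by move: ih; rewrite -/s; lra.
rewrite -expect_lincomb; apply: expect_le => x sx.
by rewrite -sx; apply: le_trans (step_damp x) _; rewrite /=; lra.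
Qed.

(** The steps [forget beta n] sum to infinity like the harmonic series, so the
    loss cannot stay away from [0]. *)
Lemma expect_damp_loss_small e : 0 < e ->
  exists n, expect beta n (damp_loss \o mass beta) < e.
Proof.
move=> e0; apply: contrapT => /forallNP /= loss_ge.
have b0 := beta_gt0.
have p1 : 0 < 1 - p by rewrite subr_gt0.
apply: (@dvg_harmonic R); apply: nondecreasing_is_cvgn.
  by apply/nondecreasing_seqP => n; rewrite seriesSr lerDl invr_ge0.
exists ((1 + beta) / (beta * e * (1 - p))) => _ [n _ <-].
rewrite seriesEord /= ler_pdivlMr ?mulr_gt0//.
have damp1 : damp 1 <= 1.
  by rewrite /damp ler_pdivrMr; lra.
have pos : 0 <= expect beta n (damp \o mass beta).
  rewrite -[leLHS](expect_cst n 0); apply: expect_le => x _ /=.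
  by rewrite divr_ge0 ?addr_ge0 ?mass_ge0.
have := le_trans pos (expect_damp_le n).
suff : (\sum_(i < n) (i.+1%:R^-1 : R)) * (beta * e) <= (1 + beta) *
    \sum_(i < n) forget beta i.+1 * expect beta i (damp_loss \o mass beta).
  by set s := \sum_(i < n) _; set s' := \sum_(i < n) _ => ss' h; nra.
rewrite mulr_suml mulr_sumr; apply: ler_sum => i _.
have /negP := loss_ge i; rewrite -leNgt => ei.
have -> : i.+1%:R^-1 * (beta * e) = (i.+1%:R^-1 * beta) * e by ring.
rewrite mulrA ler_pM ?(ltW e0)//.
  by rewrite mulr_ge0// ltW.
have i1 : 1 <= i.+1%:R :> R by rewrite ler1n.
rewrite /forget mulrA ler_pdivlMr ?addn_beta_gt0//.
have -> : i.+1%:R^-1 * beta * (i.+1%:R + beta) = beta + beta * beta / i.+1%:R.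
  by field; rewrite gt_eqF//; lra.
by rewrite mulrDl mul1r lerD2l ler_pdivrMr; nra.
Qed.

(** A small loss means that the mass is near [0] or large; the second case is
    excluded by [expect_mass] and Markov's inequality. *)
Lemma expect_damp_small e : 0 < e ->
  exists n, expect beta n (damp \o mass beta) <= e.
Proof.
(* [K] separates small from large masses: Markov's bound [K^-1] is [e / 2], and
   [C] bounds [damp t / damp_loss t] for [t <= K]. *)
move=> e0; set K := 2 / e; set C := (1 + K) * (2 + K).
have K0 : 0 < K by rewrite divr_gt0.
have C0 : 0 < C by rewrite mulr_gt0// addr_gt0.
have [n small] := @expect_damp_loss_small (e / 2 / C) ltac:(by rewrite !divr_gt0).
exists n; apply: (@le_trans _ _ (expect beta n (fun x =>
    C * (damp_loss \o mass beta) x + K^-1 * mass beta x))); last first.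
  rewrite expect_lincomb expect_mass mulr1.
  have : C * expect beta n (damp_loss \o mass beta) <= e / 2.
    by rewrite mulrC -ler_pdivlMr// ltW.
  have -> : K^-1 = e / 2 by rewrite /K invf_div.
  lra.
apply: expect_le => x _ /=; move: (mass_ge0 x); set t := mass beta x => t0.
have [tK|Kt] := leP t K.
  apply: (@le_trans _ _ (C * damp_loss t)); last first.
    by rewrite lerDl mulr_ge0// invr_ge0 ltW.
  have -> : C * damp_loss t = t * (C / ((1 + t) ^+ 2 * (2 + t))).
    by rewrite /damp_loss; ring.
  rewrite /damp ler_wpM2l//.
  have pos : 0 < (1 + t) ^+ 2 * (2 + t) by rewrite mulr_gt0 ?exprn_gt0//; lra.
  rewrite ler_pdivlMr//.
  have -> : (1 + t)^-1 * ((1 + t) ^+ 2 * (2 + t)) = (1 + t) * (2 + t).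
    by field; rewrite gt_eqF//; lra.
  by rewrite /C ler_pM//; lra.
apply: (@le_trans _ _ (K^-1 * t)).
  apply: (@le_trans _ _ 1); first by rewrite /damp ler_pdivrMr; lra.
  by rewrite mulrC ler_pdivlMr// mul1r ltW.
by rewrite lerDr mulr_ge0 ?damp_loss_ge0// ltW.
Qed.

(** Doob's maximal inequality for the nonnegative supermartingale
    [damp \o mass beta], frozen at [1/2] by the first new nonzero step: such a
    step makes the mass at least [1]. *)
Lemma expect_new_hit_le n j :
  expect beta (n + j) (fun x => (has id (take j x))%:R) <=
  2 * expect beta n (damp \o mass beta).
Proof.
pose F i x := if has id (take i x) then 2^-1 else damp (mass beta x).
have damp_half t : 1 <= t -> 2^-1 <= damp t.
  by move=> t1; rewrite /damp ler_pdivlMr; lra.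
have damp_ge0 t : 0 <= t -> 0 <= damp t.
  by move=> t0; rewrite divr_ge0// addr_ge0.
have stepF i x : step beta (F i.+1) x <= F i x.
  rewrite /step /F /=; case: ifPn => hx; first by lra.
  have := step_damp x; rewrite /step /= addr0 => hd.
  apply: (@le_trans _ _ (damp (mass beta x))) => //.
  have : 0 <= forget beta (size x) * ((1 - p) * damp_loss (mass beta x)).
    rewrite mulr_ge0 ?(ltW (forget_gt0 _))// mulr_ge0 ?subr_ge0 ?(ltW p_lt1)//.
    exact: damp_loss_ge0 (mass_ge0 _).
  have : hit beta x / 2 <=
      hit beta x * damp ((1 - forget beta (size x)) * mass beta x + 1).
    rewrite ler_wpM2l ?hit_ge0// damp_half// lerDr mulr_ge0 ?mass_ge0//.
    by rewrite subr_ge0 forget_le1.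
  move: hd; lra.
have expectF : expect beta (n + j) (F j) <= expect beta n (damp \o mass beta).
  elim: j => [|j ih]; first by rewrite addn0; apply: expect_le => x; rewrite /F take0.
  rewrite addnS /=; apply: le_trans ih.
  by apply: expect_le => x _; exact: stepF.
apply: (@le_trans _ _ (expect beta (n + j) (fun x => 2 * F j x + 0 * F j x))).
  apply: expect_le => x _; rewrite /F; case: ifP => _ /=; first by lra.
  by have := damp_ge0 _ (mass_ge0 x); lra.
by rewrite expect_lincomb mul0r addr0 ler_wpM2l.
Qed.

Lemma expect_new_hit_small e : 0 < e ->
  exists n, forall j, expect beta (n + j) (fun x => (has id (take j x))%:R) <= e.
Proof.
move=> e0; have [n hn] := @expect_damp_small (e / 2) ltac:(by rewrite divr_gt0).
exists n => j; apply: le_trans (expect_new_hit_le n j) _.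
by move: hn; lra.
Qed.

End critical.
End zero_pattern_chain.

(** * The memory weights *)

Section memory_weights.
Context {R : realType} (p beta : R) (m : nat -> R).
Hypotheses (hp : 0 < p < 1) (hbeta : beta = p / (1 - p)).
Hypothesis m_pmf : forall n, (1 <= n)%N ->
  \sum_(1 <= k < n.+1) (beta + 1) / n%:R * (m k / m n.+1) = 1.

Lemma weight_sum n : (1 <= n)%N ->
  (beta + 1) * \sum_(1 <= k < n.+1) m k = n%:R * m n.+1 /\ m n.+1 != 0.
Proof.
move=> n1; have := m_pmf n1.
have n0 : n%:R != 0 :> R by rewrite pnatr_eq0 -lt0n.
rewrite -mulr_sumr -mulr_suml; have [->|mn] := eqVneq (m n.+1) 0.
  by rewrite invr0 !mulr0 => /eqP; rewrite eq_sym oner_eq0.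
set s := \sum_(_ <= _ < _) _ => h; split=> //.
have -> : (beta + 1) * s =
    n%:R * m n.+1 * ((beta + 1) / n%:R * (s / m n.+1)).
  by field; rewrite mn n0.
by rewrite h mulr1.
Qed.

Lemma weight_neq0 n : (1 <= n)%N -> m n != 0.
Proof.
case: n => [//|[_|n _]]; last by have [] := @weight_sum n.+1 isT.
have [+ m2] := @weight_sum 1 isT; rewrite big_nat1 mul1r => e.
by apply: contraNneq m2 => e1; rewrite -e e1 mulr0.
Qed.

(** Being probability mass functions for every [n] determines the weights up to
    a common factor; in particular the recursion of the Gamma function is
    contained in the normalization. *)
Lemma weight_rec n : (1 <= n)%N -> m n = (1 - forget beta n) * m n.+1.
Proof.
move=> n1; have nb : n%:R + beta != 0 by rewrite gt_eqF// (addn_beta_gt0 hp hbeta).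
suff e : n%:R * m n.+1 = (n%:R + beta) * m n.
  apply: (mulfI nb); rewrite -e /forget; field; exact: nb.
case: n n1 {nb} => [//|[_|n _]].
  by have [<- _] := @weight_sum 1 isT; rewrite big_nat1; ring.
have [<- _] := @weight_sum n.+2 isT; have [h _] := @weight_sum n.+1 isT.
by rewrite big_nat_recr//= mulrDr h -(natr1 n.+1); ring.
Qed.

Lemma mass_weights x : (1 <= size x)%N ->
  \sum_(1 <= k < (size x).+1) m k * (nth false x (size x - k))%:R =
  m (size x) * mass beta x.
Proof.
elim: x => [//|v x ih] _ /=; rewrite big_nat_recr//= subnn /=.
rewrite mulrDr; congr (_ + _).
case: (posnP (size x)) ih => [x0 _|x_gt0 ih].
  by rewrite x0 big_geq// (size0nil x0) /= !mulr0.
rewrite mulrA [_ * (1 - _)]mulrC -weight_rec// -ih//.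
by apply: eq_big_nat => k /andP[k1 kx]; rewrite subSn.
Qed.

(** [hit] is the conditional probability, given the pattern so far, that the
    next step is nonzero: a nonzero step has to be remembered and repeated. *)
Lemma hit_weights x : (1 <= size x)%N ->
  p * \sum_(1 <= k < (size x).+1)
        (beta + 1) / (size x)%:R * (m k / m (size x).+1) *
        (nth false x (size x - k))%:R = hit beta x.
Proof.
move=> x1; have mn := @weight_neq0 (size x).+1 isT.
rewrite (eq_bigr (fun k => (beta + 1) / (size x)%:R / m (size x).+1 *
    (m k * (nth false x (size x - k))%:R))); last by move=> k _; ring.
rewrite -mulr_sumr mass_weights// (weight_rec x1) /hit.
have n0 : (size x)%:R != 0 :> R by rewrite pnatr_eq0 -lt0n.
have nb : (size x)%:R + beta != 0 by rewrite gt_eqF// (addn_beta_gt0 hp hbeta).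
have pb : p * (beta + 1) = beta by have := beta_critical hp hbeta; lra.
have -> : 1 - forget beta (size x) = (size x)%:R / ((size x)%:R + beta).
  by rewrite /forget; field; exact: nb.
have -> : forget beta (size x) = p * (beta + 1) / ((size x)%:R + beta).
  by rewrite pb.
by field; rewrite n0 nb mn.
Qed.

End memory_weights.

(** * The law of the zero pattern of the walk *)

Section walk_law.
Context (d : measure_display) (T : measurableType d) (R : realType).
Variable P : probability T R.

Lemma independent_cylinder d' (T' : measurableType d') (Y : nat -> T -> T')
    (y : nat -> T') m :
  (forall t : T', measurable [set t]) ->
  independent_RVs P [set n | (2 <= n)%N] Y ->
  P [set w | forall i, (i < m)%N -> Y (2 + i)%N w = y i] =
  (\prod_(i < m) P [set w | Y (2 + i)%N w = y i])%E.
Proof.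
move=> m1 indY; pose J := [fset j in iota 2 m]%fset.
have inJ j : (j \in J) = (2 <= j < 2 + m)%N by rewrite inE mem_iota.
have -> : [set w | forall i, (i < m)%N -> Y (2 + i)%N w = y i] =
    \bigcap_(j in [set` J]) [set w | Y j w = y (j - 2)%N].
  apply/seteqP; split => w /= h.
    move=> j /=; rewrite inJ => /andP[j2 jm].
    by have := h (j - 2)%N; rewrite subnKC//; apply; rewrite ltn_subLR.
  move=> i im; have := h (2 + i)%N; rewrite /= inJ ltn_add2l leq_addr im.
  by move=> /(_ isT) ->; rewrite addKn.
rewrite indY.
- rewrite (perm_big (iota 2 m)); last first.
    apply: uniq_perm; [exact: fset_uniq|exact: iota_uniq|].
    by move=> j; rewrite inJ mem_iota.
  have -> : iota 2 m = index_iota (0 + 2) (m + 2) by rewrite /index_iota addnK.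
  rewrite big_addn addnK big_mkord; apply: eq_bigr => i _.
  by rewrite addnK addnC.
- by move=> j /=; rewrite inJ => /andP[].
- by move=> j _; exists [set y (j - 2)%N]; rewrite ?setTI.
Qed.

Lemma cylinder_sigma_RVs d' (T' : measurableType d') (Y : nat -> T -> T')
    (y : nat -> T') m :
  (forall t : T', measurable [set t]) ->
  sigma_RVs [set n | (2 <= n)%N] Y
    [set w | forall i, (i < m)%N -> Y (2 + i)%N w = y i].
Proof.
move=> m1; rewrite /sigma_RVs; set G := \bigcup_(n in _) _.
have -> : [set w | forall i, (i < m)%N -> Y (2 + i)%N w = y i] =
    \bigcap_(i in `I_m) [set w | Y (2 + i)%N w = y i] by [].
apply: (@bigcap_measurableType _ (g_sigma_algebraType G)) => i _.
apply: sub_sigma_algebra; exists (2 + i)%N => //=.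
by exists [set y i] => //; rewrite setTI.
Qed.

Variables (p beta : R).
Variables (alpha : nat -> {RV P >-> bool}) (b : nat -> {RV P >-> nat}).
Variable X : nat -> {RV P >-> nat}.
Hypotheses (hp : 0 < p < 1) (hbeta : beta = p / (1 - p)).
Hypothesis hX : laziest_erw p beta alpha b X.

Definition pmf_alpha (a : bool) : R := if a then p else 1 - p.

Definition pmf_b n k : R := fine (P [set w | b n w = k]).

(** The event that [(alpha n, b n)], [(alpha n.+1, b n.+1)], ... take the
    values listed in [h]. *)
Fixpoint cylinder n (h : seq (bool * nat)) : set T :=
  if h is c :: h' then
    [set w | alpha n w = c.1 /\ b n w = c.2] `&` cylinder n.+1 h'
  else setT.

Fixpoint cylinder_weight n (h : seq (bool * nat)) : R :=
  if h is c :: h' then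
    pmf_alpha c.1 * pmf_b n c.2 * cylinder_weight n.+1 h'
  else 1.

Lemma cylinderE n h : cylinder n h =
  [set w | forall i, (i < size h)%N -> alpha (n + i) w = (nth (true, 0%N) h i).1] `&`
  [set w | forall i, (i < size h)%N -> b (n + i) w = (nth (true, 0%N) h i).2].
Proof.
elim: h n => [|c h ih] n /=.
  by apply/esym; rewrite -subTset => w _.
rewrite ih; apply/seteqP; split => w /=.
  move=> [[ac bc] [ah bh]].
  by split => -[|i] //= hi; rewrite ?addn0// -addSnnS; [exact: ah|exact: bh].
move=> [ah bh]; split; first by have := ah 0%N; have := bh 0%N; rewrite addn0; auto.
split => i hi; rewrite addSnnS; [exact: (ah i.+1)|exact: (bh i.+1)].
Qed.

Lemma cylinder_weightE n h : cylinder_weight n h =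
  (\prod_(i < size h) pmf_alpha (nth (true, 0%N) h i).1) *
  (\prod_(i < size h) pmf_b (n + i) (nth (true, 0%N) h i).2).
Proof.
elim: h n => [|c h ih] n /=; first by rewrite !big_ord0 mulr1.
rewrite !big_ord_recl/= ih addn0.
under [X in _ * (_ * X) = _]eq_bigr do rewrite addSnnS.
ring.
Qed.

Lemma measurable_RV_eq d' (T' : measurableType d') (Y : {RV P >-> T'}) (t : T') :
  measurable [set t] -> measurable [set w | Y w = t].
Proof. by move=> mt; exact: (measurable_funPTI Y mt). Qed.

Lemma P_alpha n a : (2 <= n)%N -> P [set w | alpha n w = a] = (pmf_alpha a)%:E.
Proof.
case: n => // n n1; rewrite -[LHS]/(distribution P (alpha n.+1) [set a]).
rewrite (lerw_alpha_bernoulli hX)// bernoulli_probE; last first.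
  by case/andP: hp => /ltW -> /ltW ->.
rewrite !diracE; case: a.
- by rewrite mem_set// memNset ?mule0 ?adde0 ?mule1//.
- by rewrite memNset// mem_set// mule0 add0e mule1.
Qed.

Lemma P_b n k : P [set w | b n w = k] = (pmf_b n k)%:E.
Proof. by rewrite fineK// fin_num_measure//; exact: measurable_RV_eq. Qed.

Lemma P_cylinder h : P (cylinder 2 h) = (cylinder_weight 2 h)%:E.
Proof.
rewrite cylinderE (lerw_alpha_b_indep hX); last 2 first.
- exact: (cylinder_sigma_RVs (fun i => (nth (true, 0%N) h i).1)).
- exact: (cylinder_sigma_RVs (fun i => (nth (true, 0%N) h i).2)).
have := independent_cylinder (fun i => (nth (true, 0%N) h i).1) (size h) _
  (lerw_alpha_indep hX).
move=> /(_ (fun=> I)) ->.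
have := independent_cylinder (fun i => (nth (true, 0%N) h i).2) (size h) _
  (lerw_b_indep hX).
move=> /(_ (fun=> I)) ->.
rewrite cylinder_weightE EFinM !(big_morph _ (@EFinM R) (erefl 1%:E)); congr (_ * _)%E.
- by apply: eq_bigr => i _; exact: P_alpha.
- by apply: eq_bigr => i _; exact: P_b.
Qed.

Lemma measurable_cylinder n h : measurable (cylinder n h).
Proof.
elim: h n => [|c h ih] n //=; apply: measurableI => //.
by apply: measurableI; exact: measurable_RV_eq.
Qed.

Lemma split_alpha n (B : set T) : measurable B ->
  P B = (P (B `&` [set w | alpha n w = true]) +
         P (B `&` [set w | alpha n w = false]))%E.
Proof.
move=> mB; rewrite -measureU.
- congr (P _); apply/seteqP; split => [w Bw|w [|] []//] /=.
  by case: (alpha n w); [left|right].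
- by apply: measurableI => //; exact: measurable_RV_eq.
- by apply: measurableI => //; exact: measurable_RV_eq.
- by apply/seteqP; split => // w [[_ /= ->]] [].
Qed.

Lemma split_b n (B : set T) : (1 <= n)%N -> measurable B ->
  P B = (\sum_(1 <= k < n.+1) P (B `&` [set w | b n.+1 w = k]))%E.
Proof.
move=> n1 mB.
have mBk k : measurable (B `&` [set w | b n.+1 w = k]).
  by apply: measurableI => //; exact: measurable_RV_eq.
have null k : ~~ (1 <= k <= n)%N -> P (B `&` [set w | b n.+1 w = k]) = 0%E.
  move=> kn; apply: (@subset_measure0 _ _ _ P _ [set w | b n.+1 w = k]) => //.
  - exact: measurable_RV_eq.
  - by have := lerw_b_pmf hX k n1; rewrite (negPf kn).
rewrite -[in LHS](setIT B).
have -> : [set: T] = \bigcup_k [set w | b n.+1 w = k].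
  by apply/seteqP; split => // w _; exists (b n.+1 w).
rewrite setI_bigcupr measure_semi_bigcup//; last 2 first.
- by move=> i j _ _ [w [[_ /= <-] [_ /= <-]]].
- exact: bigcupT_measurable.
apply/cvg_lim => //; apply: cvg_near_cst; exists n.+1 => // m /= nm.
rewrite (@big_cat_nat _ _ _ n.+1)//= [X in (_ + X)%E]big1_seq; last first.
  move=> k /=; rewrite mem_index_iota => /andP[nk _].
  by rewrite null// (leqNgt k n) nk andbF.
by rewrite adde0 big_ltn// null// add0e.
Qed.

Lemma pmf_b_sum n : (1 <= n)%N -> \sum_(1 <= k < n.+1) pmf_b n.+1 k = 1.
Proof.
move=> n1; apply: EFin_inj; rewrite -(probability_setT P) (split_b n1)//.
by rewrite -sumEFin; apply: eq_bigr => k _; rewrite setTI P_b.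
Qed.

Lemma pmf_bE n k : (1 <= k <= n)%N ->
  pmf_b n.+1 k = (beta + 1) / n%:R * (mu beta k / mu beta n.+1).
Proof.
move=> kn; have n1 : (1 <= n)%N by case/andP: kn; exact: leq_trans.
by rewrite /pmf_b (lerw_b_pmf hX)// kn.
Qed.

Lemma hit_pmf x : (1 <= size x)%N ->
  p * \sum_(1 <= k < (size x).+1)
        pmf_b (size x).+1 k * (nth false x (size x - k))%:R = hit beta x.
Proof.
move=> x1; rewrite -(hit_weights hp hbeta (m := mu beta))//; last first.
  move=> n n1; rewrite -[RHS](pmf_b_sum n1).
  by apply: eq_big_nat => k kn; rewrite pmf_bE.
by congr (_ * _); apply: eq_big_nat => k kn; rewrite pmf_bE.
Qed.

Fixpoint pattern n (w : T) : seq bool :=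
  if n is m.+1 then (X m.+2 w != 0%N) :: pattern m w else [:: X 1%N w != 0%N].

Lemma size_pattern n w : size (pattern n w) = n.+1.
Proof. by elim: n => //= n ->. Qed.

Lemma nth_pattern n k w : (1 <= k <= n.+1)%N ->
  nth false (pattern n w) (n.+1 - k) = (X k w != 0%N).
Proof.
elim: n k => [|n ih] k /andP[k1 kn].
  by have -> : k = 1%N by apply/eqP; rewrite eqn_leq kn.
move: kn; rewrite leq_eqVlt => /predU1P[->|kn]; first by rewrite subnn.
by rewrite subSn//= ih// k1.
Qed.

Lemma expect_sum n (r : seq nat) (c : nat -> R) (F : nat -> seq bool -> R) :
  expect beta n (fun x => \sum_(k <- r) c k * F k x) =
  \sum_(k <- r) c k * expect beta n (F k).
Proof.
elim: r => [|k r ih].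
  rewrite big_nil -[RHS](expect_cst beta n 0).
  by apply: eq_expect => x _; rewrite big_nil.
rewrite big_cons -ih -[X in _ + X]mul1r -expect_lincomb.
by apply: eq_expect => x _; rewrite big_cons mul1r.
Qed.

Lemma measurable_pattern n (G : pred (seq bool)) :
  measurable [set w | G (pattern n w)].
Proof.
have mX k : measurable [set w | X k w = 0%N] by exact: measurable_RV_eq.
elim: n G => [|n ih] G /=.
  have -> : [set w | G [:: X 1%N w != 0%N]] =
      ([set w | X 1%N w = 0%N] `&` [set _ | G [:: false]]) `|`
      (~` [set w | X 1%N w = 0%N] `&` [set _ | G [:: true]]).
    apply/seteqP; split => w /=; case: eqP => e; tauto.
  by apply: measurableU; apply: measurableI => //; try exact: measurableC;
    case: (G _); rewrite ?set_true ?set_false.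
have -> : [set w | G ((X n.+2 w != 0%N) :: pattern n w)] =
    ([set w | X n.+2 w = 0%N] `&` [set w | G (false :: pattern n w)]) `|`
    (~` [set w | X n.+2 w = 0%N] `&` [set w | G (true :: pattern n w)]).
  apply/seteqP; split => w /=; case: eqP => e; tauto.
apply: measurableU; apply: measurableI => //; try exact: measurableC.
- exact: (ih (fun x => G (false :: x))).
- exact: (ih (fun x => G (true :: x))).
Qed.

(** The cylinder over later variables is carried along because the induction
    trades the last step of the pattern for one more variable in the cylinder;
    at [n = 0] only the independence of the [alpha]s and [b]s is left. *)
Lemma pattern_law n (G : pred (seq bool)) h :
  P ([set w | G (pattern n w)] `&` cylinder n.+2 h) =
  (expect beta n (fun x => (G x)%:R) * cylinder_weight n.+2 h)%:E.
Proof.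
elim: n G h => [|n ih] G h.
  have -> : [set w | G (pattern 0 w)] = [set _ | G [:: true]].
    by apply/seteqP; split => w /=; rewrite (lerw_init hX).
  rewrite /=; case: (G _) => /=.
    by rewrite set_true setTI mul1r P_cylinder.
  by rewrite set_false set0I measure0 mul0r.
set B := (X in P X).
have mB : measurable B.
  by apply: measurableI; [exact: measurable_pattern|exact: measurable_cylinder].
pose G' a k x := G ((a && nth false x (n.+1 - k)) :: x).
have BE a k : (1 <= k < n.+2)%N ->
    P (B `&` [set w | alpha n.+2 w = a] `&` [set w | b n.+2 w = k]) =
    (pmf_alpha a * pmf_b n.+2 k * expect beta n (fun x => (G' a k x)%:R) *
      cylinder_weight n.+3 h)%:E.
  move=> kn.
  have -> : B `&` [set w | alpha n.+2 w = a] `&` [set w | b n.+2 w = k] =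
      [set w | G' a k (pattern n w)] `&` cylinder n.+2 ((a, k) :: h).
    have pE w : alpha n.+2 w = a -> b n.+2 w = k ->
        (X n.+2 w != 0%N) = a && nth false (pattern n w) (n.+1 - k).
      move=> aw bw; rewrite (lerw_step hX)// aw bw nth_pattern//.
      by case: (a); rewrite ?mul1n.
    apply/seteqP; split => w.
      move=> [[[GB cw] aw] bw]; split; last by [].
      by rewrite /mkset /G' -(pE w aw bw).
    move=> [GB [[aw bw] cw]]; do 3 (split; last by []).
    by rewrite /mkset -[pattern _ _]/((X n.+2 w != 0%N) :: pattern n w) (pE w aw bw).
  by rewrite ih /=; congr (_%:E); ring.
rewrite (split_alpha n.+2 mB) (@split_b n.+1 (B `&` [set w | alpha n.+2 w = true]))//; last first.
  by apply: measurableI => //; exact: measurable_RV_eq.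
rewrite (@split_b n.+1 (B `&` [set w | alpha n.+2 w = false]))//; last first.
  by apply: measurableI => //; exact: measurable_RV_eq.
rewrite (eq_big_nat _ _ (BE true)) (eq_big_nat _ _ (BE false)) !sumEFin -EFinD.
congr (_%:E); rewrite -!mulr_suml -mulrDl; congr (_ * _).
rewrite -!expect_sum -[LHS]mul1r mulrDr -expect_lincomb.
rewrite [RHS]/=; apply: eq_expect => x sx.
have hitE := @hit_pmf x; rewrite sx in hitE.
rewrite /step -(hitE isT) !mul1r.
set s := \sum_(1 <= k < n.+2) pmf_b n.+2 k * (nth false x (n.+1 - k))%:R.
set G1 := (G (true :: x))%:R; set G0 := (G (false :: x))%:R.
have -> : \sum_(1 <= k < n.+2) pmf_alpha true * pmf_b n.+2 k * (G' true k x)%:R =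
    p * G0 * \sum_(1 <= k < n.+2) pmf_b n.+2 k + p * (G1 - G0) * s.
  rewrite !mulr_sumr -big_split; apply: eq_bigr => k _ /=.
  by rewrite /G' /G0 /G1; case: (nth _ _ _) => /=; ring.
have -> : \sum_(1 <= k < n.+2) pmf_alpha false * pmf_b n.+2 k * (G' false k x)%:R =
    (1 - p) * G0 * \sum_(1 <= k < n.+2) pmf_b n.+2 k.
  by rewrite mulr_sumr; apply: eq_bigr => k _; rewrite /G' /G0 /=; ring.
by rewrite pmf_b_sum//; ring.
Qed.

(** * Finiteness of the number of nonzero steps *)

Definition new_hit n j : set T := [set w | has id (take j (pattern (n + j) w))].

Lemma new_hitP n j w :
  new_hit n j w <-> exists2 m, (n.+1 < m <= (n + j).+1)%N & X m w != 0%N.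
Proof.
rewrite /new_hit /mkset; elim: j => [|j ih].
  rewrite take0; split => // -[m]; rewrite addn0 => /andP[nm mn].
  by have := leq_trans nm mn; rewrite ltnn.
rewrite addnS; split => /=.
  move=> /orP[Xn|/ih[m /andP[nm mj] Xm]]; last first.
    by exists m => //; rewrite nm leqW.
  by exists (n + j).+2 => //; rewrite leqnn andbT ltnS ltnS leq_addr.
move=> [m /andP[nm]]; rewrite leq_eqVlt => /predU1P[-> Xm|mj Xm]; first by rewrite Xm.
by apply/orP; right; apply/ih; exists m => //; rewrite nm.
Qed.

Lemma measurable_new_hit n j : measurable (new_hit n j).
Proof. exact: (measurable_pattern _ (fun x => has id (take j x))). Qed.

Lemma P_new_hit n j : P (new_hit n j) =
  (expect beta (n + j) (fun x => (has id (take j x))%:R))%:E.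
Proof.
have := pattern_law (n + j) (fun x => has id (take j x)) [::].
by rewrite /= setIT mulr1.
Qed.

Lemma walk_infty_ltP w :
  (walk_infty R (fun n => X n : T -> nat) w < +oo)%E <->
  exists n, forall j, ~ new_hit n j w.
Proof.
pose Y := fun n => X n : T -> nat.
have walkS n : walk Y n.+1 w = (walk Y n w + X n.+1 w)%N.
  by rewrite /walk big_nat_recr.
split=> [fin|[n none]].
  have [[N wN]|woo] := walk_infty_nat R Y w; last by rewrite -/Y woo in fin.
  have bw k : (walk Y k w <= N)%N.
    rewrite -(ler_nat R) -lee_fin -wN.
    have nd : nondecreasing_seq (fun k => ((walk Y k w)%:R%:E : \bar R)).
      by move=> i j ij; rewrite lee_fin ler_nat walk_nondecreasing.
    rewrite /walk_infty (cvg_lim _ (ereal_nondecreasing_cvgn nd))//.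
    by apply: ereal_sup_ubound; exists k.
  have exw : exists k, `[< exists n, walk Y n w = k >].
    by exists (walk Y 0 w); apply/asboolP; exists 0%N.
  have bounded k : `[< exists n, walk Y n w = k >] -> (k <= N)%N.
    by move=> /asboolP[i <-].
  case: (ex_maxnP exw bounded) => k /asboolP[n nk] maxk; exists n => j.
  move=> /new_hitP[[//|m] /andP[nm _]]; rewrite -lt0n => Xm.
  have kw : (k <= walk Y m w)%N by rewrite -nk walk_nondecreasing// ltnW// -ltnS.
  have : (walk Y m.+1 w <= k)%N by apply: maxk; apply/asboolP; exists m.+1.
  rewrite walkS leqNgt (leq_ltn_trans kw)//.
  by rewrite -[ltnLHS]addn0 ltn_add2l.
suff -> : walk_infty R Y w = (walk Y n.+1 w)%:R%:E by rewrite ltry.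
apply/cvg_lim => //; apply: cvg_near_cst; exists n.+1 => // m /= nm.
congr (_%:R%:E); rewrite -(subnKC nm); elim: (m - n.+1)%N => [|i ih].
  by rewrite addn0.
rewrite addnS walkS ih; have [->|Xi] := eqVneq (X (n.+1 + i).+1 w) 0%N.
  by rewrite addn0.
case: (none i.+1); apply/new_hitP; exists (n.+1 + i).+1 => //.
by rewrite addnS addSn leqnn andbT !ltnS leq_addr.
Qed.

Lemma measurable_hits_forever :
  measurable (\bigcap_n \bigcup_j new_hit n j).
Proof.
apply: bigcapT_measurable => n.
by apply: bigcupT_measurable => j; exact: measurable_new_hit.
Qed.

(** A nonzero step after time [n.+1] has, for a suitable [n], a probability
    small uniformly in the horizon [j], so the bound passes to the limit. *)
Lemma P_hits_forever : P (\bigcap_n \bigcup_j new_hit n j) = 0%E.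
Proof.
apply/eqP; rewrite eq_le measure_ge0 andbT; apply/lee_addgt0Pr => e e0.
rewrite add0e; have [n hn] := expect_new_hit_small hp hbeta e0.
have mU : measurable (\bigcup_j new_hit n j).
  by apply: bigcupT_measurable => j; exact: measurable_new_hit.
apply: (@le_trans _ _ (P (\bigcup_j new_hit n j))).
  apply: le_measure; rewrite ?inE//; first exact: measurable_hits_forever.
  exact: bigcap_inf.
have nd : nondecreasing_seq (new_hit n).
  move=> i j ij; apply/subsetPset => w /new_hitP[m /andP[nm mi] Xm].
  by apply/new_hitP; exists m => //; rewrite nm (leq_trans mi)// ltnS leq_add2l.
have cv := nondecreasing_cvg_mu (mu := P) (measurable_new_hit n) mU nd.
rewrite -(cvg_lim _ cv)//; apply: lime_le; first by apply/cvg_ex; eexists; exact: cv.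
by apply: nearW => j /=; rewrite P_new_hit lee_fin.
Qed.

End walk_law.

Theorem theorem2p5 (d : measure_display) (T : measurableType d) (R : realType)
  (P : probability T R) (p beta : R)
  (alpha : nat -> {RV P >-> bool}) (b : nat -> {RV P >-> nat})
  (X : nat -> {RV P >-> nat})
  (hp : 0 < p < 1) (hbeta : beta = p / (1 - p))
  (hX : laziest_erw p beta alpha b X) :
  P [set w | (walk_infty R (fun n => X n : T -> nat) w < +oo)%E] = 1%E.
Proof.
have -> : [set w | (walk_infty R (fun n => X n : T -> nat) w < +oo)%E] =
    ~` \bigcap_n \bigcup_j new_hit X n j.
  apply/seteqP; split => w.
    move=> /(walk_infty_ltP X w)[n none] /(_ n I)[j _]; exact: none.
  move=> /= h; apply/(walk_infty_ltP X w); apply: contrapT => /forallNP/= all_hit.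
  apply: h => n _; have /existsNP[j /contrapT hj] := all_hit n; by exists j.
rewrite probability_setC; last exact: measurable_hits_forever.
by rewrite (P_hits_forever hp hbeta hX) sube0.
Qed.
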